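(* Let $q\in\mathbb{C}$ with $0<|q|<1$ and write $\alpha_k=\alpha(q,k)$. The $q$-exponential function $\mathcal{E}_{q,\alpha}(z)$ satisfies $$\mathcal{E}_{q,\alpha}(-z)=\left(\mathcal{E}_{q,\alpha}(z)\right)^{-1}$$ (as power series in $z$) if and only if $\alpha(q,0)=1$ and, for every $p=1,2,\dots$, with $n=2p$, $$2\sum_{k=0}^{p-1}\binom{n}{k}_q(-1)^k\alpha_k\alpha_{n-k}=\binom{n}{p}_q(-1)^{p+1}\alpha_p^2 .$$
   Context: For $q\neq1$, $[n]_q=\frac{1-q^n}{1-q}$, $[n]_q!=[1]_q[2]_q\cdots[n]_q$ with $[0]_q!=1$, and $\binom{n}{k}_q=\frac{[n]_q!}{[k]_q!\,[n-k]_q!}$. The parameter $\alpha(q,n)$ is a complex-valued function of $q$ and of the integer $n\ge 0$, with $\alpha(q,n)\to1$ as $q\to1^-$. The unified $q$-exponential function is $$\mathcal{E}_{q,\alpha}(z)=\sum_{n=0}^{\infty}\frac{z^n}{[n]_q!}\,\alpha(q,n).$$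
   Formalization: The formal statement additionally assumes α(q,0) ≠ −1; without it the claim fails, e.g. if at the given q one has α(q,0) = −1 and α(q,n) = 0 for n ≥ 1, then E = −1 satisfies E(−z) = E(z)^{-1} but α(q,0) ≠ 1. *)

(* Defs.v *)
From HB Require Import structures.
From mathcomp Require Import all_boot all_order all_algebra.
From mathcomp Require Import complex.
From mathcomp Require Import all_classical all_reals all_analysis.

Set Implicit Arguments.
Unset Strict Implicit.
Unset Printing Implicit Defensive.

Import Order.TTheory GRing.Theory Num.Theory numFieldNormedType.Exports.
Local Open Scope classical_set_scope.
Local Open Scope ring_scope.
Local Open Scope complex_scope.

Section QCalculus.
Variable F : fieldType.
Implicit Types (q : F) (n k : nat).

Definition qnumber q n : F := (1 - q ^+ n) / (1 - q).

Definition qfactorial q n : F := \prod_(1 <= j < n.+1) qnumber q j.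

(* Only meaningful for [k <= n]: [n - k] is truncated. *)
Definition qbinomial q n k : F :=
  qfactorial q n / (qfactorial q k * qfactorial q (n - k)).

End QCalculus.

(* A formal power series is its sequence of coefficients. *)
Definition fps (F : fieldType) : Type := nat -> F.

Section FormalPowerSeries.
Variable F : fieldType.
Implicit Types f g : fps F.

Definition fps_one : fps F := fun n => (n == 0%N)%:R.

Definition fps_mul f g : fps F :=
  fun n => \sum_(k < n.+1) f k * g (n - k)%N.

(* [f (- z)] *)
Definition fps_opparg f : fps F := fun n => (-1) ^+ n * f n.

(* [g] is the multiplicative inverse of [f] in the ring of formal power
   series; that ring is commutative, so such a [g] is unique. *)
Definition fps_is_inverse f g : Prop := fps_mul f g =1 fps_one.

End FormalPowerSeries.

(* The limit [q --> 1^-] is taken along real [q]; the alias [^o] gives [R[i]]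
   its normed topology. *)
Definition qexp_parameter (R : realType) (alpha : R[i] -> nat -> R[i]) : Prop :=
  forall n : nat,
    (alpha x%:C n : R[i]^o) @[x --> (1 : R)^'-] --> (1 : R[i]^o).

Definition qexp (R : realType) (alpha : R[i] -> nat -> R[i]) (q : R[i]) :
    fps R[i] :=
  fun n => alpha q n / qfactorial q n.

(* Main.v *)
Require Import Defs.
From HB Require Import structures.
From mathcomp Require Import all_boot all_order all_algebra.
From mathcomp Require Import complex zify ring.
From mathcomp Require Import all_classical all_reals all_analysis.

Set Implicit Arguments.
Unset Strict Implicit.
Unset Printing Implicit Defensive.

Import Order.TTheory GRing.Theory Num.Theory numFieldNormedType.Exports.
Local Open Scope ring_scope.
Local Open Scope complex_scope.

(** The product [f(z) f(-z)] is unchanged by [z |-> -z], so its coefficients of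
    odd index vanish for every series [f] (characteristic other than two), and
    the odd coefficients impose no condition on [alpha]
    ([fps_mul_opparg_odd]).

    In the coefficient of index [2p], the terms of indices [k] and [2p - k]
    agree, because [(-1)^k] and [(-1)^(2p - k)] do.  The sum is therefore
    twice its first half plus the middle term
    ([fps_mul_opparg_double]).  Multiplied by [[2p]_q!], which is nonzero since
    [q] is not a root of unity, it becomes the left-hand side minus the
    right-hand side of the identity on [alpha]
    ([qfactorial_mul_coef_double]).

    There remains the constant coefficient [alpha(q,0)^2], which equals [1]
    exactly when [alpha(q,0)] is [1] or [-1].  Both roots occur, since replacing
    [f] by [-f] does not change [f(z) f(-z)]; the hypothesis
    [alpha(q,0) <> -1] selects the root [1]. *)

Lemma sumr_fold_middle (V : nmodType) (h : nat -> V) (p : nat) :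
    (forall k, (k < p)%N -> h (p.*2 - k)%N = h k) ->
  \sum_(k < p.*2.+1) h k = (\sum_(0 <= k < p) h k) *+ 2 + h p.
Proof.
move=> h_sym; rewrite -(big_mkord xpredT h).
rewrite (big_cat_nat _ (n := p)) //=; last by rewrite -addnn leqW ?leq_addr.
rewrite [X in _ + X]big_ltn; last by rewrite -addnn ltnS leq_addr.
rewrite mulr2n -addrA; congr (_ + _); rewrite addrC; congr (_ + _).
rewrite big_nat_rev -{1}[p.+1]add0n big_addn subSS -addnn addnK.
rewrite big_nat [RHS]big_nat; apply: eq_bigr => k /andP[_ lt_kp].
rewrite -(h_sym _ lt_kp) -addnn; congr h; lia.
Qed.

Section FormalPowerSeries.
Variable F : fieldType.
Implicit Types f g : fps F.

Lemma fps_mulC f g : fps_mul f g =1 fps_mul g f.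
Proof.
move=> n; rewrite /fps_mul (reindex_inj rev_ord_inj) /=.
apply: eq_bigr => k _; have le_kn : (k <= n)%N by rewrite -ltnS.
by rewrite subSS subKn // [LHS]mulrC.
Qed.

Lemma fps_oppargM f g :
  fps_opparg (fps_mul f g) =1 fps_mul (fps_opparg f) (fps_opparg g).
Proof.
move=> n; rewrite /fps_opparg /fps_mul mulr_sumr; apply: eq_bigr => k _.
have le_kn : (k <= n)%N by rewrite -ltnS.
by rewrite mulrACA -exprD subnKC.
Qed.

Lemma fps_oppargK f : fps_opparg (fps_opparg f) =1 f.
Proof. by move=> n; rewrite /fps_opparg signrMK. Qed.

(** Substituting [-z] for [z] in [f(z) f(-z)] exchanges the two factors, so
    this product is an even series. *)
Lemma fps_mul_opparg_odd f (n : nat) : (2 : F) != 0 -> odd n ->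
  fps_mul f (fps_opparg f) n = 0.
Proof.
move=> two_neq0 n_odd; set c := LHS.
have even_c : - c = c.
  (* As [n] is odd, [- c] is [(-1) ^+ n * c], a coefficient of the product
     with [z] replaced by [-z]. *)
  rewrite -mulN1r -[-1]expr1 -[1%N]/(nat_of_bool true) -n_odd signr_odd.
  rewrite -/(fps_opparg (fps_mul f (fps_opparg f)) n) fps_oppargM fps_mulC.
  by apply: eq_bigr => k _; rewrite fps_oppargK.
have /eqP : 2 * c = 0 by rewrite mulr_natl mulr2n -{1}even_c addNr.
by rewrite mulf_eq0 (negPf two_neq0) => /eqP.
Qed.

(** The reflection [k |-> 2p - k] preserves the parity of [k], so the
    terms it exchanges are equal and the sum folds around [k = p]. *)
Lemma fps_mul_opparg_double f (p : nat) :
  fps_mul f (fps_opparg f) p.*2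
  = (\sum_(0 <= k < p) (-1) ^+ k * f k * f (p.*2 - k)%N) *+ 2
    + (-1) ^+ p * f p ^+ 2.
Proof.
pose h k := (-1) ^+ k * f k * f (p.*2 - k)%N.
have sign_sub k : (k <= p.*2)%N -> (-1) ^+ (p.*2 - k) = (-1) ^+ k :> F.
  by move=> le_k; rewrite -signr_odd oddB // odd_double signr_odd.
transitivity (\sum_(k < p.*2.+1) h k).
  apply: eq_bigr => k _; have le_k : (k <= p.*2)%N by rewrite -ltnS.
  by rewrite /fps_opparg sign_sub // mulrCA mulrA.
rewrite sumr_fold_middle => [|k lt_kp].
  have mid_sub : (p.*2 - p = p)%N by rewrite -addnn addnK.
  by rewrite /h mid_sub expr2 mulrA.
have le_k : (k <= p.*2)%N by rewrite -addnn ltnW // ltn_addr.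
by rewrite /h sign_sub // subKn // mulrAC.
Qed.

End FormalPowerSeries.

Section QCoefficients.
Variable F : fieldType.
Implicit Types (q : F) (a : nat -> F) (n k p : nat).

Lemma qfactorial0 q : qfactorial q 0 = 1.
Proof. by rewrite /qfactorial big_nil. Qed.

(** Since [q ^+ 1 != 1], the denominators [1 - q] do not vanish either. *)
Lemma qfactorial_neq0 q n :
  (forall j, (0 < j)%N -> q ^+ j != 1) -> qfactorial q n != 0.
Proof.
move=> q_nroot; have nz j : (0 < j)%N -> 1 - q ^+ j != 0.
  by move=> /q_nroot; rewrite subr_eq0 eq_sym.
rewrite /qfactorial big_nat prodf_seq_neq0; apply/allP => j _.
apply/implyP => /andP[j_gt0 _].
by rewrite mulf_neq0 ?invr_eq0 ?nz // -[q]expr1 nz.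
Qed.

Lemma qbinomialE q a n k :
  qbinomial q n k * a k * a (n - k)%N
  = qfactorial q n
    * ((a k / qfactorial q k) * (a (n - k)%N / qfactorial q (n - k))).
Proof. by rewrite /qbinomial invfM; ring. Qed.

(** Multiplication by [[2p]_q!] turns each [1 / ([k]_q! [2p - k]_q!)] into a
    q-binomial.  The middle term, of sign [(-1)^p], is written as minus a term
    of sign [(-1)^(p+1)], so that the vanishing of this expression reads as an
    equation between the folded half and the middle term. *)
Lemma qfactorial_mul_coef_double q a p (f := fun n => a n / qfactorial q n) :
  qfactorial q (2 * p) * fps_mul f (fps_opparg f) (2 * p)%N
  = 2 * (\sum_(0 <= k < p)
           qbinomial q (2 * p) k * (-1) ^+ k * a k * a (2 * p - k)%N)
    - qbinomial q (2 * p) p * (-1) ^+ p.+1 * a p ^+ 2.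
Proof.
have mid_sub : (p.*2 - p = p)%N by rewrite -addnn addnK.
have Emid := qbinomialE q a p.*2 p; rewrite mid_sub in Emid.
have Ehalf : \sum_(0 <= k < p)
      qbinomial q p.*2 k * (-1) ^+ k * a k * a (p.*2 - k)%N
    = qfactorial q p.*2 * \sum_(0 <= k < p) (-1) ^+ k * f k * f (p.*2 - k)%N.
  rewrite mulr_sumr; apply: eq_bigr => k _.
  transitivity ((-1) ^+ k * (qbinomial q p.*2 k * a k * a (p.*2 - k)%N)).
    by ring.
  by rewrite qbinomialE -/(f k) -/(f (p.*2 - k)%N); ring.
rewrite mul2n fps_mul_opparg_double Ehalf.
transitivity (2 * (qfactorial q p.*2
                   * \sum_(0 <= k < p) (-1) ^+ k * f k * f (p.*2 - k)%N)
              + (-1) ^+ p * (qbinomial q p.*2 p * a p * a p)).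
  by rewrite Emid -/(f p); ring.
by rewrite exprS; ring.
Qed.

End QCoefficients.

Theorem proposition9 (R : realType) (alpha : R[i] -> nat -> R[i])
    (halpha : qexp_parameter alpha)
    (q : R[i]) (hq0 : 0 < `|q|) (hq1 : `|q| < 1)
    (hsign : alpha q 0%N <> -1) :
  fps_is_inverse (qexp alpha q) (fps_opparg (qexp alpha q)) <->
  alpha q 0%N = 1 /\
  forall p : nat, (1 <= p)%N ->
    2 * \sum_(0 <= k < p)
          qbinomial q (2 * p)%N k * (-1) ^+ k
            * alpha q k * alpha q (2 * p - k)%N
    = qbinomial q (2 * p)%N p * (-1) ^+ p.+1 * alpha q p ^+ 2.
Proof.
have q_nroot j : (0 < j)%N -> q ^+ j != 1.
  move=> j_gt0; apply/eqP => /(congr1 Num.norm); rewrite normrX normr1 => /eqP.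
  by rewrite lt_eqF // exprn_ilt1 // -lt0n.
set f := qexp alpha q.
have coef0 : fps_mul f (fps_opparg f) 0%N = alpha q 0%N ^+ 2.
  by rewrite /fps_mul big_ord1 /fps_opparg /f /qexp qfactorial0 mul1r divr1.
have coef_double p := qfactorial_mul_coef_double q (alpha q) p.
split=> [inv_f | [alpha0 alphaE] n].
  split=> [|p p_gt0].
    move: (inv_f 0%N); rewrite coef0 => /eqP.
    by rewrite sqrf_eq1 => /orP[/eqP | /eqP].
  apply/eqP; rewrite -subr_eq0 -coef_double.
  by rewrite inv_f /fps_one muln_eq0 /= -leqn0 leqNgt p_gt0 mulr0.
have [n_odd | n_even] := boolP (odd n).
  rewrite fps_mul_opparg_odd ?pnatr_eq0 // /fps_one.
  by case: n n_odd.
have -> : n = (2 * n./2)%N by rewrite mul2n even_halfK.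
case: (posnP n./2) => [-> | p_gt0]; first by rewrite muln0 coef0 alpha0 expr1n.
apply: (mulfI (qfactorial_neq0 (2 * n./2) q_nroot)).
rewrite coef_double alphaE // subrr.
by rewrite /fps_one muln_eq0 /= -leqn0 leqNgt p_gt0 mulr0.
Qed.
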